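(* Let $\{(V_i,X_i,d_i)\}_{i\in I}$ be a family of continuity spaces. Put $X=\coprod_{i\in I}X_i$ (disjoint union), let $U$ be the set of all functions $R:X\to\coprod_{i\in I}(V_i)_\prec$ with $R(x)\in(V_i)_\prec$ whenever $x\in X_i$, put $V=\Omega(U)$, and define $d:X\times X\to V$ by $$d(a,b)=\{A\in[U]^{<\omega}\mid \text{for every } R\in A \text{ there is a walk } w(a,b) \text{ in } X \text{ from } a \text{ to } b \text{ with } R\vdash w(a,b)\}.$$ Then $(V,X,d)$ is the coproduct $\coprod_{i\in I}(V_i,X_i,d_i)$ in the category $\mathbf{M}_{\mathbf{T}}$ (with the canonical inclusions $X_i\to X$).
   Context: For a complete lattice $L$ with bottom $\bot$ and $x,y\in L$, write $y\succ x$ (equivalently $x\prec y$; ''$y$ is well above $x$'') if whenever $S\subseteq L$ and $x\ge\bigwedge S$, there is $s\in S$ with $y\ge s$. A value distributive lattice is a completely distributive complete lattice $L$ for which $L_\prec=\{a\in L\mid a\succ\bot\}$ is a filter. A value quantale is a value distributive lattice $V$ with an associative commutative binary operation $+:V\times V\to V$ such that $x+\bot=x$ for all $x\in V$ and $\bigwedge(x+S)=x+\bigwedge S$ for all $x\in V$, $S\subseteq V$. A continuity space $(V,X,d)$ consists of a value quantale $V$, a set $X$ and a function $d:X\times X\to V$ with $d(x,x)=\bot$ and $d(x,z)\le d(x,y)+d(y,z)$ for all $x,y,z\in X$. $\mathbf{M}_{\mathbf{T}}$ is the category whose objects are all continuity spaces and whose morphisms $(V,X,d)\to(W,Y,m)$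 are the functions $f:X\to Y$ such that for every $x\in X$ and every $\epsilon\in W_\prec$ there is $\delta\in V_\prec$ such that for all $x'\in X$, $d(x,x')\prec\delta$ implies $m(f(x),f(x'))\prec\epsilon$. For $\epsilon\succ\bot$ put $B_\epsilon(x)=\{y\in X\mid d(x,y)\prec\epsilon\}$. The topology generated by $(V,X,d)$ consists of those $O\subseteq X$ such that for every $x\in O$ there is $\epsilon\succ\bot$ with $B_\epsilon(x)\subseteq O$. Sending a continuity space to the topological space it generates, and a morphism to its underlying function, is an equivalence of categories $\mathcal{O}:\mathbf{M}_{\mathbf{T}}\to\mathbf{Top}$, so the conclusion amounts to $(V,X,d)$ generating the topological sum of the spaces $\mathcal{O}[(V_i,X_i,d_i)]$. For a set $Y$, $[Y]^{<\omega}$ is the set of finite subsets of $Y$, and $\Omega(Y)$ is the set of all $A\subseteq[Y]^{<\omega}$ that are downwards closed ($B\subseteq C\in A$ implies $B\in A$). Ordered by reverse inclusion, with $+$ given by intersection, $\Omega(Y)$ is a value quantale in which $p\succ\bot$ if and only if $p$ is finite. A walk in $X$ from $a$ to $b$ is a finite sequence $a=x_1,\dots,x_n=b$ of points of $X$. For $R\in U$, $R\vdash (x_1,\dots,x_n)$ means that for every $k\le n-1$, if $x_k\in X_i$ then $x_{k+1}\in X_i$ and $d_i(x_k,x_{k+1})\prec R(x_k)$ in $V_i$; in particular no walk containing points of different factors is admitted. *)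

(* Defs.v *)
From HB Require Import structures.
From mathcomp Require Import all_boot all_order.
From mathcomp Require Import boolp classical_sets functions cardinality.

Set Implicit Arguments.
Unset Strict Implicit.
Unset Printing Implicit Defensive.

Import Order.TTheory.
Local Open Scope classical_set_scope.
Local Open Scope order_scope.

#[local] Obligation Tactic := idtac.

HB.mixin Record isCompleteLattice d (T : Type) of Order.TBLattice d T := {
  Inf : set T -> T;
  Sup : set T -> T;
  Inf_infimums : forall S : set T, infimums S (Inf S);
  Sup_supremums : forall S : set T, supremums S (Sup S)
}.

#[short(type="completeLatticeType")]
HB.structure Definition CompleteLattice d :=
  { T of isCompleteLattice d T & Order.TBLattice d T }.

HB.mixin Record isCompletelyDistributive d (T : Type)
    of CompleteLattice d T := {
  InfSup_distr : forall (J : Type) (K : J -> Type) (x : forall j, K j -> T),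
    Inf (range (fun j => Sup (range (x j)))) =
    Sup (range (fun f : forall j, K j => Inf (range (fun j => x j (f j)))))
}.

#[short(type="complDistrLatticeType")]
HB.structure Definition ComplDistrLattice d :=
  { T of isCompletelyDistributive d T & CompleteLattice d T }.

Definition well_above d (L : completeLatticeType d) (y x : L) : Prop :=
  forall S : set L, Inf S <= x -> exists2 s, S s & s <= y.

Notation "x \prec y" := (well_above y x) (at level 70, no associativity).

(* Nonempty but not required to be proper: in the two-element chain [\bot] is
   well above itself, so its set of elements well above [\bot] is everything. *)
Definition lattice_filter d (L : latticeType d) (F : set L) : Prop :=
  [/\ F !=set0,
      forall a b, F a -> a <= b -> F b &
      forall a b, F a -> F b -> F (a `&` b)].

HB.mixin Record isValueDistributive d (T : Type)
    of ComplDistrLattice d T := {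
  prec_bot_filter : lattice_filter [set a : T | \bot \prec a]
}.

#[short(type="valueDistrLatticeType")]
HB.structure Definition ValueDistrLattice d :=
  { T of isValueDistributive d T & ComplDistrLattice d T }.

HB.mixin Record isValueQuantale d (T : Type) of ValueDistrLattice d T := {
  qadd : T -> T -> T;
  qaddA : associative qadd;
  qaddC : commutative qadd;
  qaddx0 : right_id \bot qadd;
  qadd_Inf : forall (x : T) (S : set T),
    Inf [set qadd x s | s in S] = qadd x (Inf S)
}.

#[short(type="valueQuantaleType")]
HB.structure Definition ValueQuantale d :=
  { T of isValueQuantale d T & ValueDistrLattice d T }.

Record contSpace := ContSpace {
  cs_disp : Order.disp_t;
  cs_val : valueQuantaleType cs_disp;
  cs_pt :> Type;
  cs_dist : cs_pt -> cs_pt -> cs_val;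
  cs_dist_refl : forall x, cs_dist x x = \bot;
  cs_dist_triangle : forall x y z,
    cs_dist x z <= qadd (cs_dist x y) (cs_dist y z)
}.

Definition cs_continuous (X Y : contSpace) (f : X -> Y) : Prop :=
  forall (x : X) (eps : cs_val Y), \bot \prec eps ->
  exists2 delta : cs_val X, \bot \prec delta &
    forall x' : X, cs_dist x x' \prec delta -> cs_dist (f x) (f x') \prec eps.

Record morphism (X Y : contSpace) := Morphism {
  mor_fun :> X -> Y;
  mor_continuous : cs_continuous mor_fun
}.

Record category := Category {
  obj :> Type;
  hom : obj -> obj -> Type;
  idm : forall X, hom X X;
  comp : forall X Y Z, hom Y Z -> hom X Y -> hom X Z;
  comp_idl : forall X Y (f : hom X Y), comp (idm Y) f = f;
  comp_idr : forall X Y (f : hom X Y), comp f (idm X) = f;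
  compA : forall X Y Z W (h : hom Z W) (g : hom Y Z) (f : hom X Y),
    comp h (comp g f) = comp (comp h g) f
}.

Definition is_coproduct (C : category) (I : Type) (F : I -> C) (P : C)
    (inj : forall i, hom (F i) P) : Prop :=
  forall (Q : C) (f : forall i, hom (F i) Q),
  exists! g : hom P Q, forall i, comp g (inj i) = f i.

Lemma morphism_eq (X Y : contSpace) (f g : morphism X Y) :
  mor_fun f = mor_fun g -> f = g.
Proof.
case: f g => f fc [g gc] /= fg; move: fc gc; rewrite fg => fc gc.
by congr Morphism; exact: Prop_irrelevance.
Qed.

Lemma cs_continuous_id (X : contSpace) : cs_continuous (fun x : X => x).
Proof. by move=> x e e0; exists e. Qed.

Lemma cs_continuous_comp (X Y Z : contSpace) (g : Y -> Z) (f : X -> Y) :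
  cs_continuous g -> cs_continuous f -> cs_continuous (fun x => g (f x)).
Proof.
move=> gc fc x e /(gc (f x))[e' /(fc x)[e'' e''0 fe] ge].
by exists e'' => // x' /fe /ge.
Qed.

Program Definition M_T : category := {|
  obj := contSpace;
  hom := morphism;
  idm := fun X => Morphism (@cs_continuous_id X);
  comp := fun X Y Z g f =>
    Morphism (cs_continuous_comp (mor_continuous g) (mor_continuous f))
|}.
Next Obligation. by move=> X Y f; exact: morphism_eq. Qed.
Next Obligation. by move=> X Y f; exact: morphism_eq. Qed.
Next Obligation. by move=> X Y Z W h g f; exact: morphism_eq. Qed.

Record Omega (Y : Type) := MkOmega {
  om_set : set (set Y);
  om_fin : forall A, om_set A -> finite_set A;
  om_down : forall A B, B `<=` A -> om_set A -> om_set B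
}.

Section OmegaValueQuantale.
Variable Y : Type.
Implicit Types (p q : Omega Y) (S : set (Omega Y)).

Lemma Omega_eq p q : (forall A, om_set p A <-> om_set q A) -> p = q.
Proof.
case: p q => p pf pd [q qf qd] /= pq.
have {}pq : p = q by apply/funext => A; exact/propext.
move: pf pd qf qd; rewrite pq => pf pd qf qd.
by congr MkOmega; exact: Prop_irrelevance.
Qed.

HB.instance Definition _ := gen_eqMixin (Omega Y).
HB.instance Definition _ := gen_choiceMixin (Omega Y).

(* The order is reverse inclusion, so infima are unions and suprema (as well as
   the addition) are intersections. *)
Definition om_le p q : bool := `[< om_set q `<=` om_set p >].

Fact om_le_refl : reflexive om_le.
Proof. by move=> p; exact/asboolP. Qed.

Fact om_le_anti : antisymmetric om_le.
Proof.
by move=> p q /andP[/asboolP qp /asboolP pq]; apply: Omega_eq => A; split;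
  [exact: pq|exact: qp].
Qed.

Fact om_le_trans : transitive om_le.
Proof.
move=> q p r /asboolP qp /asboolP rq; apply/asboolP => A /rq; exact: qp.
Qed.

Fact omega_display : Order.disp_t. Proof. exact: Order.Disp tt tt. Qed.

HB.instance Definition _ := Order.Le_isPOrder.Build omega_display (Omega Y)
  om_le_refl om_le_anti om_le_trans.

Lemma om_leP p q : reflect (om_set q `<=` om_set p) (p <= q).
Proof. exact: asboolP. Qed.

Program Definition om_bot : Omega Y := {| om_set := [set A | finite_set A] |}.
Next Obligation. by []. Qed.
Next Obligation. by move=> A B /= BA; exact: sub_finite_set. Qed.

Program Definition om_top : Omega Y := {| om_set := set0 |}.
Next Obligation. by []. Qed.
Next Obligation. by []. Qed.

Program Definition om_cup p q : Omega Y :=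
  {| om_set := om_set p `|` om_set q |}.
Next Obligation. by move=> p q A []; exact: om_fin. Qed.
Next Obligation.
by move=> p q A B BA [] h; [left|right]; exact: om_down h.
Qed.

Program Definition om_cap p q : Omega Y :=
  {| om_set := om_set p `&` om_set q |}.
Next Obligation. by move=> p q A [+ _]; exact: om_fin. Qed.
Next Obligation.
by move=> p q A B BA [pA qA]; split; [exact: om_down pA|exact: om_down qA].
Qed.

Program Definition om_Inf S : Omega Y :=
  {| om_set := [set A | exists2 p, S p & om_set p A] |}.
Next Obligation. by move=> S A [p _]; exact: om_fin. Qed.
Next Obligation. by move=> S A B BA [p Sp pA]; exists p => //; exact: om_down pA. Qed.

Program Definition om_Sup S : Omega Y :=
  {| om_set := [set A | finite_set A /\ forall p, S p -> om_set p A] |}.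
Next Obligation. by move=> S A []. Qed.
Next Obligation.
move=> S A B BA [Afin SA]; split; first exact: sub_finite_set Afin.
by move=> p Sp; exact: om_down (SA p Sp).
Qed.

Fact om_le0x p : om_bot <= p.
Proof. by apply/om_leP => A; exact: om_fin. Qed.

Fact om_lex1 p : p <= om_top.
Proof. exact/om_leP. Qed.

Fact om_meetP p q r : (p <= om_cup q r) = (p <= q) && (p <= r).
Proof.
apply/om_leP/andP => [h|[/om_leP h1 /om_leP h2] A [/h1|/h2]//].
by split; apply/om_leP => A ?; apply: h; [left|right].
Qed.

Fact om_joinP p q r : (om_cap p q <= r) = (p <= r) && (q <= r).
Proof.
apply/om_leP/andP => [h|[/om_leP h1 /om_leP h2] A rA]; last first.
  by split; [exact: h1|exact: h2].
by split; apply/om_leP => A /h[].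
Qed.

HB.instance Definition _ :=
  Order.hasBottom.Build omega_display (Omega Y) om_le0x.
HB.instance Definition _ :=
  Order.hasTop.Build omega_display (Omega Y) om_lex1.
HB.instance Definition _ :=
  Order.POrder_MeetJoin_isLattice.Build omega_display (Omega Y)
    om_meetP om_joinP.

Fact om_Inf_infimums S : infimums S (om_Inf S).
Proof.
split=> [p Sp|p lbp]; apply/om_leP => A; first by exists p.
by case=> q /lbp /om_leP; exact.
Qed.

Fact om_Sup_supremums S : supremums S (om_Sup S).
Proof.
split=> [p Sp|p ubp]; apply/om_leP => A; first by case=> _; exact.
by move=> pA; split=> [|q /ubp /om_leP]; [exact: om_fin pA|exact].
Qed.

HB.instance Definition _ := isCompleteLattice.Build omega_display (Omega Y)
  om_Inf_infimums om_Sup_supremums.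

Fact om_InfSup_distr (J : Type) (K : J -> Type)
    (x : forall j, K j -> Omega Y) :
  Inf (range (fun j => Sup (range (x j)))) =
  Sup (range (fun f : forall j, K j => Inf (range (fun j => x j (f j))))).
Proof.
apply: Omega_eq => A; split.
  case=> _ [j _ <-] [Afin xA]; split=> // _ [f _ <-].
  by exists (x j (f j)); [exists j|apply: xA; exists (f j)].
case=> Afin xA; apply: contrapT => nA.
have h j : exists k, ~ om_set (x j k) A.
  apply: contrapT => hj; apply: nA; exists (Sup (range (x j))); first by exists j.
  split=> // _ [k _ <-]; apply: contrapT => xjk; apply: hj; by exists k.
pose f j := projT1 (cid (h j)).
have [|_ [j _ <-]] := xA (Inf (range (fun j => x j (f j)))); first by exists f.
exact: (projT2 (cid (h j))).
Qed.

HB.instance Definition _ :=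
  isCompletelyDistributive.Build omega_display (Omega Y) om_InfSup_distr.

Program Definition om_principal (A : set Y) (Afin : finite_set A) : Omega Y :=
  {| om_set := [set B | B `<=` A] |}.
Next Obligation. by move=> A Afin B BA; exact: sub_finite_set Afin. Qed.
Next Obligation. by move=> A Afin B C CB BA; exact: subset_trans BA. Qed.

Lemma om_prec_bot p : (\bot : Omega Y) \prec p <->
  exists A (Afin : finite_set A), om_principal Afin <= p.
Proof.
split=> [|[A [Afin /om_leP pA]] S /om_leP SA].
  case/(_ [set q | exists A (Afin : finite_set A), q = om_principal Afin]).
    by apply/om_leP => A Afin; exists (om_principal Afin) => //; exists A, Afin.
  by move=> _ [A [Afin ->]] Ap; exists A, Afin.
have [s Ss sA] := SA _ Afin; exists s => //.
by apply/om_leP => B /pA BA; exact: om_down sA.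
Qed.

Fact om_prec_bot_filter : lattice_filter [set p : Omega Y | \bot \prec p].
Proof.
split=> [|p q p0 pq S /p0[s Ss sp]|p q].
- exists \top; apply/om_prec_bot; exists set0, (@finite_set0 Y); exact: lex1.
- by exists s => //; exact: le_trans pq.
- move=> /om_prec_bot[A [Af /om_leP pA]] /om_prec_bot[B [Bf /om_leP qB]].
  have ABf : finite_set (A `|` B) by rewrite finite_setU.
  apply/om_prec_bot; exists (A `|` B), ABf; apply/om_leP => C [/pA|/qB] h.
    exact/(subset_trans h)/subsetUl.
  exact/(subset_trans h)/subsetUr.
Qed.

HB.instance Definition _ :=
  isValueDistributive.Build omega_display (Omega Y) om_prec_bot_filter.

Fact om_capA : associative om_cap.
Proof. by move=> p q r; apply: Omega_eq => A /=; rewrite /setI /=; tauto. Qed.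

Fact om_capC : commutative om_cap.
Proof. by move=> p q; apply: Omega_eq => A /=; rewrite /setI /=; tauto. Qed.

Fact om_capx0 : right_id \bot om_cap.
Proof.
by move=> p; apply: Omega_eq => A; split=> [[]//|pA]; split=> //; exact: om_fin pA.
Qed.

Fact om_cap_Inf p S : Inf [set om_cap p q | q in S] = om_cap p (Inf S).
Proof.
apply: Omega_eq => A; split=> [[_ [q Sq <-] [pA qA]]|[pA [q Sq qA]]].
  by split=> //; exists q.
by exists (om_cap p q) => //; exists q.
Qed.

HB.instance Definition _ := isValueQuantale.Build omega_display (Omega Y)
  om_capA om_capC om_capx0 om_cap_Inf.

End OmegaValueQuantale.

Section CoproductSpace.
Variables (I : Type) (F : I -> contSpace).

Definition cop_pt : Type := {i & cs_pt (F i)}.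

Definition cop_inj (i : I) (x : F i) : cop_pt := Tagged (fun i => cs_pt (F i)) x.

Definition cop_scale : Type :=
  forall x : cop_pt, {eps : cs_val (F (tag x)) | \bot \prec eps}.

(* A step stays in the summand of its starting point [x], where its length is
   measured against the tolerance that [R] attaches to [x]. *)
Definition cop_step (R : cop_scale) (x y : cop_pt) : Prop :=
  exists2 v : F (tag x),
    y = cop_inj v & cs_dist (tagged x) v \prec sval (R x).

(* Walks list both endpoints; the one-point walk from [a] to [a] is allowed. *)
Definition is_walk (a b : cop_pt) (w : seq cop_pt) : Prop :=
  exists2 s, w = a :: s & last a s = b.

Definition follows (R : cop_scale) (w : seq cop_pt) : Prop :=
  sorted (fun x y => `[< cop_step R x y >]) w.

Program Definition cop_dist (a b : cop_pt) : Omega cop_scale :=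
  {| om_set := [set A | finite_set A /\
       forall R, A R -> exists2 w, is_walk a b w & follows R w] |}.
Next Obligation. by move=> a b A []. Qed.
Next Obligation.
move=> a b A B BA [Afin Aw]; split; first exact: sub_finite_set Afin.
by move=> R /BA; exact: Aw.
Qed.

Lemma cop_dist_refl a : cop_dist a a = \bot.
Proof.
apply: Omega_eq => A; split=> [[]//|Afin]; split=> // R _.
by exists [:: a] => //; exists [::].
Qed.

Lemma cop_dist_triangle a b c :
  cop_dist a c <= qadd (cop_dist a b) (cop_dist b c).
Proof.
apply/om_leP => A [[Afin ab] [_ bc]]; split=> // R AR.
have [_ [s -> sb] abR] := ab R AR; have [_ [t -> tc] bcR] := bc R AR.
exists (a :: s ++ t); first by exists (s ++ t); rewrite // last_cat sb.
by rewrite /follows /= cat_path sb; apply/andP.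
Qed.

Definition cop_space : contSpace := ContSpace cop_dist_refl cop_dist_triangle.

End CoproductSpace.

(* Main.v *)
Require Import Defs.
From mathcomp Require Import all_boot all_order.
From mathcomp Require Import boolp classical_sets functions cardinality.

(** A walk constrained by a scale R cannot leave an open set whose points R
    protects; this makes the walk distance generate the sum topology.

    The inclusions are continuous because a tolerance in Omega(U) only ever
    tests finitely many scales R, and the finitely many tolerances R(x) have a
    common lower bound that is still well above bottom ([prec_bot_lbound]).  A
    point within that bound of x is reached by a single step, for all of these
    scales at once ([cop_inj_continuous]).

    Given continuous maps f_i into a space Q, the only candidate g for the
    mediating map is f_i on the summand X_i.  For its continuity at x, consider
    the epsilon-ball around g(x).  Balls are open ([ball_open]), so each y with
    g(y) in the ball has a tolerance R(y) such that points of the summand of y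
    closer to y than R(y) are again sent into the ball.  A walk that follows R
    and starts at x therefore never leaves the preimage of the ball, so every
    point whose distance from x is well below the principal element of {R} is
    sent into the ball ([copair_continuous]).

    The openness of balls rests on complete distributivity: if p is well below
    e, then so is p + c for some c well above bottom ([prec_qadd]).  This follows from Raney's theorem that in
    a completely distributive lattice every element is the infimum of the
    elements well above it ([Inf_well_above]). *)

Set Implicit Arguments.
Unset Strict Implicit.
Unset Printing Implicit Defensive.

Import Order.TTheory.
Local Open Scope classical_set_scope.
Local Open Scope order_scope.

(** * The well-above relation in a complete lattice *)

Section CompleteLatticeTheory.
Context d (L : completeLatticeType d).
Implicit Types (x y z : L) (S : set L).

Lemma Inf_lb S x : S x -> Inf S <= x.
Proof. by move=> Sx; have [+ _] := Inf_infimums S; apply. Qed.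

Lemma le_Inf S x : (forall s, S s -> x <= s) -> x <= Inf S.
Proof. by move=> xS; have [_] := Inf_infimums S; apply. Qed.

Lemma Sup_ub S x : S x -> x <= Sup S.
Proof. by move=> Sx; have [+ _] := Sup_supremums S; apply. Qed.

Lemma Sup_le S x : (forall s, S s -> s <= x) -> Sup S <= x.
Proof. by move=> Sx; have [_] := Sup_supremums S; apply. Qed.

Lemma prec_le x y : x \prec y -> x <= y.
Proof. by move=> /(_ [set x])[|_ ->//]; exact: Inf_lb. Qed.

Lemma le_prec_trans x y z : x <= y -> y \prec z -> x \prec z.
Proof. by move=> xy yz S Sx; apply: yz; exact: le_trans xy. Qed.

Lemma prec_le_trans x y z : x \prec y -> y <= z -> x \prec z.
Proof.
by move=> xy yz S /xy[s Ss sy]; exists s => //; exact: le_trans yz.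
Qed.

End CompleteLatticeTheory.

(** * Approximation from above in completely distributive lattices *)

Section CompletelyDistributive.
Context d (L : complDistrLatticeType d).

(** Complete distributivity is self-dual.  Distributing the right-hand side
    over choice functions produces terms indexed by maps [phi] that send a
    choice function [f] to an index.  By diagonalization some index [j] has
    every [k : K j] of the form [f j] with [phi f = j], so the term of [phi]
    lies below [Inf (range (x j))]. *)
Lemma SupInf_distr (J : Type) (K : J -> Type) (x : forall j, K j -> L) :
  Sup (range (fun j => Inf (range (x j)))) =
  Inf (range (fun f : forall j, K j => Sup (range (fun j => x j (f j))))).
Proof.
apply/eqP; rewrite eq_le; apply/andP; split.
  apply: Sup_le => _ [j _ <-]; apply: le_Inf => _ [f _ <-].
  by apply: (@le_trans _ _ (x j (f j))); [apply: Inf_lb|apply: Sup_ub];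
    [exists (f j)|exists j].
rewrite (InfSup_distr _ _ (fun (f : forall j, K j) j => x j (f j))).
apply: Sup_le => _ [phi _ <-].
have [j jK] : exists j, forall k : K j,
      exists2 f : forall j, K j, phi f = j & f j = k.
  apply: contrapT => /forallNP nK.
  have {}nK j : exists k : K j,
      ~ exists2 f : forall j, K j, phi f = j & f j = k.
    exact/existsNP/nK.
  pose f j := projT1 (cid (nK j)).
  by apply: (projT2 (cid (nK (phi f)))); exists f.
apply: (@le_trans _ _ (Inf (range (x j)))); last by apply: Sup_ub; exists j.
apply: le_Inf => _ [k _ <-]; have [f phif fk] := jK k.
by apply: Inf_lb; exists f; rewrite // phif fk.
Qed.

(** Distribute over all sets [S] with [Inf S <= x]: a supremum of one member
    chosen from each such [S] is well above [x] by construction. *)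
Lemma Inf_well_above (x : L) : Inf [set a | x \prec a] = x.
Proof.
apply/eqP; rewrite eq_le; apply/andP; split; last first.
  by apply: le_Inf => a; exact: prec_le.
pose J := {S : set L | Inf S <= x}; pose K (j : J) := {s | sval j s}.
pose val (j : J) (k : K j) : L := sval k.
apply: (@le_trans _ _ (Sup (range (fun j => Inf (range (@val j)))))).
  rewrite SupInf_distr; apply: le_Inf => _ [f _ <-]; apply: Inf_lb => S Sx.
  pose j : J := exist _ S Sx; exists (val j (f j)); first exact: (svalP (f j)).
  by apply: Sup_ub; exists j.
apply: Sup_le => _ [[S Sx] _ <-]; apply: (le_trans _ Sx).
by apply: le_Inf => s Ss; apply: Inf_lb; exists (exist _ s Ss).
Qed.

(** Expanding [x] twice by [Inf_well_above] writes it as the infimum of all [a]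
    with [x \prec z] and [z \prec a] for some [z]. *)
Lemma prec_interpolate (x y : L) : x \prec y -> exists2 z, x \prec z & z \prec y.
Proof.
case/(_ [set a | exists2 z, x \prec z & z \prec a]).
  rewrite -[leRHS]Inf_well_above; apply: le_Inf => z xz.
  rewrite -[leRHS]Inf_well_above; apply: le_Inf => a za.
  by apply: Inf_lb; exists z.
by move=> a [z xz za] ay; exists z => //; exact: prec_le_trans ay.
Qed.

End CompletelyDistributive.

(** * Tolerances in value quantales *)

Lemma prec_bot_top d (V : valueDistrLatticeType d) : (\bot : V) \prec \top.
Proof. by case: (@prec_bot_filter _ V) => -[a a0] up _; exact: up (lex1 a). Qed.

Lemma prec_bot_meet d (V : valueDistrLatticeType d) (a b : V) :
  \bot \prec a -> \bot \prec b -> \bot \prec a `&` b.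
Proof. by case: (@prec_bot_filter _ V) => _ _; apply. Qed.

Lemma prec_bot_lbound d (V : valueDistrLatticeType d) (T : Type) (A : set T)
    (h : T -> V) :
  finite_set A -> (forall t, \bot \prec h t) ->
  exists2 a, \bot \prec a & forall t, A t -> a <= h t.
Proof.
move=> + h0; elim/Pchoice: T => T in A h h0 *.
move=> /finite_seqP[s ->].
elim: s => [|t s [a a0 ale]]; first by exists \top; first exact: prec_bot_top.
exists (h t `&` a); first exact: prec_bot_meet.
move=> u /=; rewrite inE => /orP[/eqP ->|us]; first exact: leIl.
by apply: le_trans (leIr _ _) _; exact: ale.
Qed.

Section ValueQuantaleTheory.
Context d (V : valueQuantaleType d).
Implicit Types a b c e p : V.

Lemma qadd_le2l a b c : b <= c -> qadd a b <= qadd a c.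
Proof.
(* Monotonicity is compatibility with the infimum of a comparable pair. *)
move=> bc; have -> : b = Inf [set b; c].
  apply/eqP; rewrite eq_le; apply/andP; split; last by apply: Inf_lb; left.
  by apply: le_Inf => s [->|->].
by rewrite -qadd_Inf; apply: Inf_lb; exists c => //; right.
Qed.

(** As addition commutes with infima, [p = p + \bot] is the infimum of all
    [p + c] with [c] well above [\bot]. *)
Lemma prec_qadd p e : p \prec e ->
  exists2 c, \bot \prec c & qadd p c \prec e.
Proof.
move=> /prec_interpolate[e' pe' e'e].
have [|_ [c c0 <-] pce'] := pe' [set qadd p c | c in [set c | \bot \prec c]].
  by rewrite qadd_Inf Inf_well_above qaddx0.
by exists c => //; exact: le_prec_trans e'e.
Qed.

End ValueQuantaleTheory.

Lemma ball_open (X : contSpace) (x z : X) (e : cs_val X) :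
  cs_dist x z \prec e ->
  exists2 c : cs_val X, \bot \prec c &
    forall u, cs_dist z u \prec c -> cs_dist x u \prec e.
Proof.
move=> /prec_qadd[c c0 xzce]; exists c => // u /prec_le zu.
apply: le_prec_trans xzce; apply: le_trans (cs_dist_triangle x z u) _.
exact: qadd_le2l.
Qed.

(** * Distances in Omega *)

Section OmegaTolerance.
Variable Y : Type.
Implicit Types (p q : Omega Y) (A : set Y).

Lemma om_prec_of_mem p q A (Afin : finite_set A) :
  om_set p A -> om_principal Afin <= q -> p \prec q.
Proof.
move=> pA /om_leP qA S /om_leP Sp; have [s Ss sA] := Sp _ pA.
by exists s => //; apply/om_leP => B /qA BA; exact: om_down sA.
Qed.

(** [p] is the infimum of the principal elements of its members, hence one of
    these lies below that of [A]. *)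
Lemma om_prec_principal p A (Afin : finite_set A) :
  p \prec om_principal Afin -> om_set p A.
Proof.
case/(_ [set q | exists B (Bfin : finite_set B),
    om_set p B /\ q = om_principal Bfin]).
  apply/om_leP => B pB; exists (om_principal (om_fin pB)) => //=.
  by exists B, (om_fin pB).
move=> _ [B [Bfin [pB ->]]] /om_leP BA.
by apply: om_down pB; exact: (BA A).
Qed.

End OmegaTolerance.

(** * The coproduct *)

Section Coproduct.
Variables (I : Type) (F : I -> contSpace).

Lemma cop_inj_continuous (i : I) :
  cs_continuous (X := F i) (Y := cop_space F) (@cop_inj I F i).
Proof.
move=> x e /om_prec_bot[A [Afin Ae]].
have [a a0 aA] :=
  prec_bot_lbound (h := fun R : cop_scale F => sval (R (cop_inj x))) Afin
                  (fun R => svalP (R (cop_inj x))).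
exists a => // x' xx'; apply: om_prec_of_mem Ae; split=> // R AR.
exists [:: cop_inj x; cop_inj x']; first by exists [:: cop_inj x'].
rewrite /follows /= andbT; apply/asboolP; exists x' => //.
exact: prec_le_trans (aA R AR).
Qed.

Definition cop_in (i : I) : morphism (F i) (cop_space F) :=
  Morphism (@cop_inj_continuous i).

Lemma follows_invariant (R : cop_scale F) (P : set (cop_pt F)) :
  (forall y z, P y -> cop_step R y z -> P z) ->
  forall a b w, is_walk a b w -> follows R w -> P a -> P b.
Proof.
move=> PR a _ _ [s -> <-]; rewrite /follows /=.
elim: s a => //= y s IHs a /andP[/asboolP ay ys] Pa.
by apply: IHs ys _; exact: PR ay.
Qed.

Variables (Q : contSpace) (f : forall i, morphism (F i) Q).

Definition copair (y : cop_space F) : Q := f (tag y) (tagged y).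

Lemma copair_continuous : cs_continuous copair.
Proof.
move=> x e e0; pose O : set Q := [set z | cs_dist (copair x) z \prec e].
(* The tolerances of a scale that keeps walks inside the preimage of the
   ball; outside this preimage any tolerance will do, and top is one. *)
have step (y : cop_pt F) :
    exists r : {eps : cs_val (F (tag y)) | \bot \prec eps},
    O (copair y) -> forall v, cs_dist (tagged y) v \prec sval r ->
    O (copair (cop_inj v)).
  have [Oy|nOy] := pselect (O (copair y)); last first.
    by exists (exist _ \top (@prec_bot_top _ _)).
  have [h h0 hO] := ball_open Oy.
  have [r r0 rh] := mor_continuous (f (tag y)) (tagged y) h0.
  by exists (exist _ r r0) => _ v /rh /hO.
pose R : cop_scale F := fun y => projT1 (cid (step y)).
have R1 : finite_set [set R] by exact: finite_set1.
exists (om_principal R1).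
  by apply/om_prec_bot; exists [set R], R1.
move=> x' /om_prec_principal[_ /(_ R erefl)[w ww Rw]].
apply: (follows_invariant (P := O \o copair) _ ww Rw) => [y z Oy [v -> yv]|].
  exact: (projT2 (cid (step y))) Oy v yv.
by rewrite /= /O /= cs_dist_refl.
Qed.

End Coproduct.

Theorem theorem13 (I : Type) (F : I -> contSpace) :
  exists inj : forall i : I, morphism (F i) (cop_space F),
    (forall (i : I) (x : F i), inj i x = cop_inj x) /\
    is_coproduct (C := M_T) inj.
Proof.
exists (cop_in F); split=> // Q f.
exists (Morphism (copair_continuous f)); split=> [i|g gf].
  by apply: morphism_eq; apply/funext.
by apply: morphism_eq; apply/funext => -[i x]; rewrite /= /copair /= -gf.
Qed.
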